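(* Consider the one-hop wireless network model described in the context, where the channel powers $\gamma_{i,j}$ are i.i.d. with the Gamma distribution (Nakagami-$m$ fading) with p.d.f. $f(x)=x^{m-1}\frac{e^{-mx/\Omega}}{\Gamma(m)(\Omega/m)^m}$ and c.d.f. $F(x)=\gamma(m,mx/\Omega)/\Gamma(m)$ for $x\ge 0$, where $m,\Omega>0$ are parameters, $\Gamma(\cdot)$ is the Gamma function and $\gamma(\cdot,\cdot)$ the lower incomplete Gamma function. Then, with high probability, the achievable throughput (obtained by activating the source-destination pairs with the largest direct-link powers and silencing the rest) satisfies $T=\Omega(\log n)$.
   Context: Network model: $n$ sources $S_1,\dots,S_n$ and $n$ destinations $D_1,\dots,D_n$; $S_i$ wishes to communicate with $D_i$ in one hop. The channel power from $S_i$ to $D_j$ is $\gamma_{i,j}\ge0$; all $\gamma_{i,j}$ are i.i.d. with mean $\mu$. A subset $\mathbb{S}$ of sources is active, each with power $1$; $SINR_i=\frac{\gamma_{i,i}}{N_0+\sum_{S_k\in\mathbb{S},k\ne i}\gamma_{k,i}}$ for $S_i\in\mathbb{S}$ (and $0$ otherwise), with noise variance $N_0\ge0$; $D_i$ succeeds if $SINR_i>\beta$ for a fixed constant $\beta>0$. The throughput $T$ is the number of successful destinations. ''With high probability'' means with probability tending to $1$ as $n\to\infty$. *)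

(* Defs.v *)
From HB Require Import structures.
From mathcomp Require Import all_boot all_order all_algebra.
From mathcomp Require Import all_classical all_reals all_analysis.
Set Implicit Arguments. Unset Strict Implicit. Unset Printing Implicit Defensive.
Import Order.TTheory GRing.Theory Num.Theory.
Import numFieldNormedType.Exports.
Local Open Scope classical_set_scope.
Local Open Scope ring_scope.

Definition Gammaf (R : realType) (a : R) : R :=
  fine (\int[@lebesgue_measure R]_(x in `[0, +oo[%classic)
          (powR x (a - 1) * expR (- x))%:E).

Definition nakagami_pdf (R : realType) (m Om : R) (x : R) : R :=
  if 0 <= x then
    powR x (m - 1) * expR (- (m * x / Om)) / (Gammaf m * powR (Om / m) m)
  else 0.

Definition has_density d (T : measurableType d) (R : realType)
  (P : probability T R) (X : T -> R) (f : R -> R) : Prop :=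
  measurable_fun setT X /\
  forall B : set R, measurable B ->
    P (X @^-1` B) = (\int[@lebesgue_measure R]_(x in B) (f x)%:E)%E.

Definition mutually_independent d (T : measurableType d) (R : realType)
  (I : finType) (P : probability T R) (X : I -> T -> R) : Prop :=
  forall B : I -> set R, (forall i, measurable (B i)) ->
    P (\bigcap_(i in [set: I]) (X i @^-1` B i)) =
    (\prod_(i : I) P (X i @^-1` B i))%E.

(* Success of destination D_i: S_i active and SINR_i > beta, where
   SINR_i = g i i / (N0 + sum_{k in S, k <> i} g k i); written without
   division so that a zero denominator means infinite SINR. *)
Definition success (R : realType) (n : nat) (g : 'I_n -> 'I_n -> R)
  (N0 beta : R) (S : {set 'I_n}) (i : 'I_n) : bool :=
  (i \in S) &&
  (beta * (N0 + \sum_(k in S | k != i) g k i) < g i i).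

Definition throughput (R : realType) (n : nat) (g : 'I_n -> 'I_n -> R)
  (N0 beta : R) (S : {set 'I_n}) : nat :=
  #|[set i | success g N0 beta S i]|.

(* The k pairs with the largest direct-link powers g i i
   (ties broken by index): i is active iff fewer than k pairs beat it. *)
Definition topk (R : realType) (n : nat) (g : 'I_n -> 'I_n -> R) (k : nat)
  : {set 'I_n} :=
  [set i | (#|[set j : 'I_n | ((g i i < g j j)%R) ||
                 ((g j j == g i i) && (nat_of_ord j < nat_of_ord i)%N)]| < k)%N].

(* Main.v *)
Require Import Defs.
From HB Require Import structures.
From mathcomp Require Import all_boot all_order all_algebra.
From mathcomp Require Import all_classical all_reals all_analysis.
From mathcomp Require Import measurable_realfun ring lra.
Import Order.TTheory GRing.Theory Num.Theory.
Import numFieldNormedType.Exports.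
Import HBNNSimple.
Local Open Scope classical_set_scope.
Local Open Scope ring_scope.

(** Put L = ln n and activate k ~ kap L pairs, with kap small.

    The density is at least a constant times exp(-a x) beyond x = 1, so with
    x = L / (2a) each direct link exceeds x with probability at least
    c n^(-1/2).  A Chernoff bound for the number of exceedances then shows that
    k of the n direct links exceed x outside an event of probability at most
    1/n; on the complement all active direct links exceed x.

    The active set depends on the direct links only, hence is independent of
    the cross links (pi-lambda theorem).  Given the active set, the interference
    at an active destination is a sum of k - 1 i.i.d. variables having a finite
    exponential moment M at theta = m / (2 Om).  By the exponential Markov
    inequality it exceeds x / beta - N0 with probability at most
    exp(-theta (x / beta - N0)) M^k, a negative power of n once kap is small.
    A union bound over the k active pairs shows that all of them succeed. *)

(** * Expectations of products *)

(** A simple function is the finite sum of its values times the indicators of its fibres, so the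
    weighted integral only depends on the integrals of weighted indicators. *)
Lemma integral_weight_nnsfun {d : measure_display} {T : measurableType d}
    {R : realType} (mu : {measure set T -> \bar R}) (X w : T -> R)
    (h : {nnsfun R >-> R}) :
  measurable_fun setT X -> measurable_fun setT w -> (forall x, 0 <= w x) ->
  (\int[mu]_x (h (X x) * w x)%:E = \sum_(y \in range h)
     y%:E * \int[mu]_x (\1_(h @^-1` [set y]) (X x) * w x)%:E)%E.
Proof.
move=> mX mw w0.
have mt y : measurable_fun setT (fun x => \1_(h @^-1` [set y]) (X x) : R).
  by apply: (@measurableT_comp _ _ _ _ _ _ (\1__ : R -> R)) => //.
under eq_integral => x _.
  rewrite fimfunE mulrC EFinM -fsumEFin // ge0_mule_fsumr; last first.
    by move=> y; exact: nnfun_muleindic_ge0.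
  over.
rewrite ge0_integral_fsum //; last 2 first.
- move=> y; apply/measurable_EFinP; apply: measurable_funM => //.
  exact: measurable_funM.
- by move=> y x _; rewrite mule_ge0 ?lee_fin//; exact: nnfun_muleindic_ge0.
apply: eq_fsbigr => y; rewrite inE => -[z _ <-].
rewrite -ge0_integralZl//.
- by apply: eq_integral => x _; rewrite -!EFinM; congr (_%:E); rewrite mulrC mulrA.
- by apply/measurable_EFinP; exact: measurable_funM.
- by move=> x _; rewrite lee_fin mulr_ge0.
- by rewrite lee_fin.
Qed.

Lemma integral_weight_approx {d : measure_display} {T : measurableType d}
    {R : realType} (mu : {measure set T -> \bar R}) (X w : T -> R)
    (f : R -> R) (mf : measurable_fun setT (EFin \o f)) :
  measurable_fun setT X -> measurable_fun setT w ->
  (forall x, 0 <= w x) -> (forall x, 0 <= f x) ->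
  (\int[mu]_x (f (X x) * w x)%:E =
   limn (fun n => \int[mu]_x (nnsfun_approx measurableT mf n (X x) * w x)%:E))%E.
Proof.
move=> mX mw w0 f0; rewrite -monotone_convergence//.
- apply: eq_integral => x _; apply/esym/cvg_lim => //.
  rewrite EFinM; under eq_fun do rewrite EFinM.
  apply: cvgeZr => //; apply: (cvg_nnsfun_approx measurableT mf) => //.
  by move=> y _; rewrite lee_fin.
- move=> n; apply/measurable_EFinP; apply: measurable_funM => //.
  exact: measurableT_comp.
- by move=> n x _; rewrite lee_fin mulr_ge0.
- move=> x _ a b ab; rewrite lee_fin ler_wpM2r//.
  exact/lefP/nd_nnsfun_approx.
Qed.

(** Agreement on indicators passes to simple functions by linearity and to [f] by monotone
    convergence. The two sides may live on different spaces, which serves both the factorisation of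
    expectations and the passage from [P] to Lebesgue measure with a density as weight. *)
Lemma eq_integral_weight {d1 d2 : measure_display} {T1 : measurableType d1}
    {T2 : measurableType d2} {R : realType} (mu1 : {measure set T1 -> \bar R})
    (mu2 : {measure set T2 -> \bar R}) (X1 w1 : T1 -> R) (X2 w2 : T2 -> R)
    (f : R -> R) :
  measurable_fun setT X1 -> measurable_fun setT w1 -> (forall x, 0 <= w1 x) ->
  measurable_fun setT X2 -> measurable_fun setT w2 -> (forall x, 0 <= w2 x) ->
  measurable_fun setT f -> (forall x, 0 <= f x) ->
  (forall B : set R, measurable B ->
    \int[mu1]_x (\1_B (X1 x) * w1 x)%:E =
    \int[mu2]_x (\1_B (X2 x) * w2 x)%:E)%E ->
  (\int[mu1]_x (f (X1 x) * w1 x)%:E = \int[mu2]_x (f (X2 x) * w2 x)%:E)%E.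
Proof.
move=> mX1 mw1 w10 mX2 mw2 w20 mf f0 indicE.
have mEf : measurable_fun setT (EFin \o f) by exact/measurable_EFinP.
rewrite !(integral_weight_approx _ _ _ _ mEf)//.
apply: congr_lim; apply/funext => n.
by rewrite !integral_weight_nnsfun//; apply: eq_fsbigr => y _; rewrite indicE.
Qed.

(** Induction on [r], replacing one indicator at a time by a general [f j]. The weight [w] and the
    constant [C] are quantified after [r] because the induction hypothesis is used with the
    indicator of [X j] absorbed into the weight. *)
Lemma expectation_prod_indep {d : measure_display} {T : measurableType d}
    {R : realType} (P : probability T R) {I : eqType} (X : I -> T -> R)
    (f : I -> R -> R) (M : I -> R) (r : seq I) :
  uniq r -> (forall i, measurable_fun setT (X i)) ->
  (forall i, measurable_fun setT (f i)) -> (forall i x, 0 <= f i x) ->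
  (forall i, \int[P]_t (f i (X i t))%:E = (M i)%:E)%E ->
  forall (w : T -> R) (C : R), measurable_fun setT w -> (forall x, 0 <= w x) ->
  0 <= C ->
  (forall B : I -> set R, (forall i, measurable (B i)) ->
    \int[P]_t (w t * \prod_(i <- r) \1_(B i) (X i t))%:E =
    C%:E * \prod_(i <- r) P (X i @^-1` B i))%E ->
  (\int[P]_t (w t * \prod_(i <- r) f i (X i t))%:E =
   (C * \prod_(i <- r) M i)%:E)%E.
Proof.
move=> + mX mf f0 fM.
have M0 i : 0 <= M i.
  by rewrite -lee_fin -fM; apply: integral_ge0 => t _; rewrite lee_fin.
have mfX i : measurable_fun setT (fun t => f i (X i t)).
  exact: measurableT_comp.
elim: r => [_ w C mw w0 C0 H|j r IH /= /andP[jr ur] w C mw w0 C0 H].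
  have := H (fun=> setT) (fun=> measurableT).
  by under eq_integral do rewrite big_nil; under [X in _ -> X = _]eq_integral do
    rewrite big_nil; rewrite !big_nil mule1 mulr1.
pose Y t := w t * \prod_(i <- r) f i (X i t).
have mY : measurable_fun setT Y.
  by apply: measurable_funM => //; apply: measurable_prod.
have Y0 t : 0 <= Y t by rewrite mulr_ge0// prodr_ge0.
have c0 : 0 <= C * \prod_(i <- r) M i by rewrite mulr_ge0// prodr_ge0.
transitivity (\int[P]_t (f j (X j t) * Y t)%:E)%E.
  by apply: eq_integral => t _; rewrite big_cons mulrCA.
transitivity (\int[P]_t (f j (X j t) * (C * \prod_(i <- r) M i))%:E)%E; last first.
  under eq_integral do rewrite EFinM.
  rewrite ge0_integralZr//; last 2 first.
  - exact/measurable_EFinP.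
  - by move=> t _; rewrite lee_fin.
  by rewrite fM -EFinM big_cons mulrCA.
apply: eq_integral_weight => // B mB.
have mi : measurable_fun setT (fun t => \1_B (X j t) : R).
  by apply: (@measurableT_comp _ _ _ _ _ _ (\1__ : R -> R)) => //.
have PjB : (\int[P]_t (\1_B (X j t))%:E = P (X j @^-1` B))%E.
  rewrite -[X in P X]setIT -integral_indic//.
  by rewrite -[X in measurable X]setTI; exact: mX.
(* The new weight is [w] times the indicator of [X j] in [B]; its constant is [C] times the
   probability of that event. *)
transitivity (\int[P]_t ((w t * \1_B (X j t)) * \prod_(i <- r) f i (X i t))%:E)%E.
  by apply: eq_integral => t _; rewrite /Y mulrCA mulrA.
have PfE : P (X j @^-1` B) = (fine (P (X j @^-1` B)))%:E.
  by rewrite fineK// fin_num_measure// -[X in measurable X]setTI; exact: mX.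
rewrite (IH ur _ (C * fine (P (X j @^-1` B)))).
- under [RHS]eq_integral do rewrite EFinM.
  rewrite ge0_integralZr//; last exact/measurable_EFinP.
  by rewrite PjB PfE -EFinM; congr (_%:E); rewrite [in LHS]mulrAC mulrC.
- exact: measurable_funM.
- by move=> t; rewrite mulr_ge0.
- by rewrite mulr_ge0// fine_ge0.
move=> B' mB'.
(* Since [j] does not occur in [r], altering the family at [j] leaves the product over [r]
   unchanged. *)
have /= := H (fun i => if i == j then B else B' i).
rewrite !big_cons eqxx => H'.
rewrite EFinM -PfE -muleA.
have E (F G : I -> \bar R) : (forall i, i != j -> F i = G i) ->
    (\prod_(i <- r) F i = \prod_(i <- r) G i)%E.
  move=> FG; rewrite big_seq [RHS]big_seq; apply: eq_bigr => i ir.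
  by apply: FG; apply: contraNneq jr => <-.
have E' (F G : I -> R) : (forall i, i != j -> F i = G i) ->
    \prod_(i <- r) F i = \prod_(i <- r) G i.
  move=> FG; rewrite big_seq [RHS]big_seq; apply: eq_bigr => i ir.
  by apply: FG; apply: contraNneq jr => <-.
rewrite (E _ (fun i => P (X i @^-1` (if i == j then B else B' i)))); last first.
  by move=> i /negbTE ->.
rewrite -H'; last by move=> i; case: ifP.
apply: eq_integral => t _; rewrite big_cons eqxx mulrA; congr (_ * _)%:E.
by apply: E' => i /negbTE ->.
Qed.

(** * Independence of disjoint groups of coordinates *)

(** The restriction of [P] to [E] and the multiple of [P] by [P E] are finite measures agreeing on
    the pi-system [G], which contains the whole space; hence they agree on the sigma-algebra it
    generates. *)
Lemma indep_g_sigma_algebra {d : measure_display} {T : measurableType d}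
    {R : realType} (P : probability T R) (G : set (set T)) (E : set T) :
  measurable E -> G `<=` measurable -> G setT -> setI_closed G ->
  (forall A, G A -> P (A `&` E) = (P A * P E)%E) ->
  forall A, <<s G >> A -> P (A `&` E) = (P A * P E)%E.
Proof.
move=> mE Gm GT GI PG A sA.
have PE : P E = (fine (P E))%:E by rewrite fineK// fin_num_measure.
have PE0 : 0 <= fine (P E) by rewrite fine_ge0.
suff : mrestr P mE A = mscale (NngNum PE0) P A.
  by rewrite /mrestr /mscale /= -PE muleC.
apply: (g_sigma_algebra_measure_unique G Gm (fun=> setT)) => //.
- by apply/seteqP; split => // x _; exists 0%N.
- move=> B GB; transitivity (P (B `&` E)) => //.
  by rewrite PG// muleC {1}PE.
- move=> _; change (P (setT `&` E) < +oo)%E.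
  by rewrite setTI PE ltry.
Qed.

Definition cylinder {d : measure_display} {T : measurableType d} {R : realType}
    {I : finType} (X : I -> T -> R) (J : pred I) (B : I -> set R) : set T :=
  \bigcap_(i in [set i | J i]) (X i @^-1` B i).

(** A pi-system generating the sigma-algebra of the coordinates selected by [J]. *)
Definition cylinders {d : measure_display} {T : measurableType d} {R : realType}
    {I : finType} (X : I -> T -> R) (J : pred I) : set (set T) :=
  [set A | exists2 B : I -> set R, (forall i, measurable (B i)) &
                                   A = cylinder X J B].

Lemma measurable_cylinder {d : measure_display} {T : measurableType d}
    {R : realType} {I : finType} (X : I -> T -> R) (J : pred I) B :
  (forall i, measurable_fun setT (X i)) -> (forall i, measurable (B i)) ->
  measurable (cylinder X J B).
Proof.
move=> mX mB; apply: fin_bigcap_measurable; first exact: finite_finset.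
by move=> i _; rewrite -[X in measurable X]setTI; exact: mX.
Qed.

Lemma setI_closed_cylinders {d : measure_display} {T : measurableType d}
    {R : realType} {I : finType} (X : I -> T -> R) (J : pred I) :
  setI_closed (cylinders X J).
Proof.
move=> _ _ [B mB ->] [C mC ->]; exists (fun i => B i `&` C i).
  by move=> i; exact: measurableI.
by rewrite /cylinder -bigcapI.
Qed.

Lemma probability_cylinder {d : measure_display} {T : measurableType d}
    {R : realType} (P : probability T R) {I : finType} (X : I -> T -> R)
    (J : pred I) (B : I -> set R) :
  mutually_independent P X -> (forall i, measurable (B i)) ->
  P (cylinder X J B) = (\prod_(i | J i) P (X i @^-1` B i))%E.
Proof.
move=> indX mB; pose C i := if J i then B i else setT.
have -> : cylinder X J B = \bigcap_(i in [set: I]) (X i @^-1` C i).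
  apply/seteqP; split => [t H i _|t H i Ji].
    by rewrite /C /=; case: ifP => // Ji; exact: H.
  by have := H i Logic.I; rewrite /C /= Ji.
rewrite indX; last by move=> i; rewrite /C; case: ifP.
rewrite [RHS]big_mkcond; apply: eq_bigr => i _; rewrite /C; case: ifP => // _.
by rewrite preimage_setT probability_setT.
Qed.

Lemma indep_cylinder {d : measure_display} {T : measurableType d}
    {R : realType} (P : probability T R) {I : finType} (X : I -> T -> R)
    (J K : pred I) (A B : I -> set R) :
  mutually_independent P X -> (forall i, ~~ (J i && K i)) ->
  (forall i, measurable (A i)) -> (forall i, measurable (B i)) ->
  P (cylinder X J A `&` cylinder X K B) =
  (P (cylinder X J A) * P (cylinder X K B))%E.
Proof.
(* As [J] and [K] are disjoint, the intersection is a single cylinder over their union. *)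
move=> indX JK mA mB; pose C i := if J i then A i else B i.
have NJ i : K i -> J i = false.
  by move=> Ki; have := JK i; rewrite Ki andbT => /negbTE.
have -> : cylinder X J A `&` cylinder X K B = cylinder X (predU J K) C.
  apply/seteqP; split => [t [H1 H2] i /=|t H].
    case/orP => Hi; last by rewrite /C NJ//; exact: H2.
    by have := H1 i Hi; rewrite /C /= Hi.
  split => i /= Hi; have := H i; rewrite /C /= Hi.
    by apply.
  by rewrite orbT NJ//; apply.
rewrite !probability_cylinder//; last by move=> i; rewrite /C; case: ifP.
rewrite (bigID J) /=; congr (_ * _)%E.
  apply: eq_big => [i|i /andP[_ Ji]]; last by rewrite /C Ji.
  by case: (J i); rewrite ?andbF.
apply: eq_big => [i|i /andP[_ Ji]]; last by rewrite /C (negbTE Ji).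
by have := JK i; case: (J i); case: (K i).
Qed.

Lemma prod_indic {T I : Type} {R : realType} (r : seq I) (A : I -> set T) t :
  \prod_(i <- r) \1_(A i) t = \1_(\big[setI/setT]_(i <- r) A i) t :> R.
Proof.
elim: r => [|i r IH]; first by rewrite !big_nil indicT.
by rewrite !big_cons IH indicI.
Qed.

(** This is [expectation_prod_indep] with weight [\1_D] and constant [P D]: an event determined by
    the coordinates in [J] is independent of every cylinder over [r]. *)
Lemma expectation_prod_sigma {d : measure_display} {T : measurableType d}
    {R : realType} (P : probability T R) {I : finType} (X : I -> T -> R)
    (J : pred I) (D : set T) (r : seq I) (f : I -> R -> R) (M : I -> R) :
  mutually_independent P X -> (forall i, measurable_fun setT (X i)) ->
  <<s cylinders X J >> D -> uniq r -> (forall i, i \in r -> ~~ J i) ->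
  (forall i, measurable_fun setT (f i)) -> (forall i x, 0 <= f i x) ->
  (forall i, \int[P]_t (f i (X i t))%:E = (M i)%:E)%E ->
  (\int[P]_t (\1_D t * \prod_(i <- r) f i (X i t))%:E =
   P D * (\prod_(i <- r) M i)%:E)%E.
Proof.
move=> indX mX sD ur rJ mf f0 fM.
have Gm : cylinders X J `<=` measurable.
  by move=> _ [B mB ->]; exact: measurable_cylinder.
have mD : measurable D.
  exact: (smallest_sub (@sigma_algebra_measurable _ T) Gm).
have PD : P D = (fine (P D))%:E by rewrite fineK// fin_num_measure.
rewrite [in RHS]PD -EFinM.
apply: expectation_prod_indep => //; first by rewrite fine_ge0.
move=> B mB; rewrite -PD.
have -> : (\prod_(i <- r) P (X i @^-1` B i))%E = P (cylinder X (mem r) B).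
  by rewrite probability_cylinder// -big_uniq.
rewrite -(indep_g_sigma_algebra _ (cylinders X J))//.
- rewrite -[X in P X]setIT -integral_indic//; last first.
    by apply: measurableI => //; exact: measurable_cylinder.
  apply: eq_integral => t _; congr (_%:E).
  rewrite indicI; congr (_ * _).
  transitivity (\prod_(i <- r) \1_(X i @^-1` B i) t : R); first by [].
  rewrite prod_indic; congr (\1_ _ t).
  by rewrite /cylinder bigcap_seq.
- exact: measurable_cylinder.
- exists (fun=> setT) => //; rewrite /cylinder; apply/seteqP; split => //.
- exact: setI_closed_cylinders.
- move=> _ [A mA ->]; apply: indep_cylinder => // i.
  by apply/negP => /andP[Ji /rJ]; rewrite Ji.
Qed.

(** * The top-k selection *)

(* [topk] and [throughput] count classical sets; these are the same counts over
   [{set 'I_n}]. *)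
Lemma card_classical {T : finType} (p : pred T) :
  #|[set i | p i]%classic| = #|[set i | p i]%SET|.
Proof.
apply: eq_card => i; rewrite finset.inE.
by apply/idP/idP => [/set_mem //|?]; exact/mem_set.
Qed.

Definition beats {R : realType} {n : nat} (g : 'I_n -> 'I_n -> R)
    (j i : 'I_n) : bool :=
  (g i i < g j j) || ((g j j == g i i) && (j < i)%N).

Lemma in_topk {R : realType} {n : nat} (g : 'I_n -> 'I_n -> R) (k : nat)
    (i : 'I_n) :
  (i \in topk g k) = (#|[set j | beats g j i]%SET| < k)%N.
Proof. by rewrite -card_classical finset.inE. Qed.

(** Thanks to the tie-break, [beats] is a strict total order, so the number of indices beating [i]
    is an injective rank with values in ['I_n], and [topk] is the preimage of the ranks below
    [k]. *)
Lemma card_topk {R : realType} {n : nat} (g : 'I_n -> 'I_n -> R) (k : nat) :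
  (k <= n)%N -> #|topk g k| = k.
Proof.
move=> kn.
pose beat i j := beats g j i.
pose A i := [set j : 'I_n | beat i j]%SET.
have irr i : beat i i = false by rewrite /beat /beats ltxx ltnn andbF.
have tot i j : i != j -> beat i j || beat j i.
  move=> ij; rewrite /beat /beats; case: (ltgtP (g i i) (g j j)) => //= _.
  by rewrite -neq_ltn eq_sym.
have tr i j l : beat i j -> beat j l -> beat i l.
  rewrite /beat /beats => /orP[ij|/andP[/eqP <- ji]] /orP[jl|/andP[/eqP jl lj]].
  - by rewrite (lt_trans ij jl).
  - by rewrite jl ij.
  - by rewrite jl.
  - by rewrite jl eqxx (ltn_trans lj ji) orbT.
(* Whatever beats [j] also beats [i], while [j] itself beats [i] but not [j]. *)
have lt_card i j : beat i j -> (#|A j| < #|A i|)%N.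
  move=> ij; apply: proper_card; apply/properP; split.
    by apply/fintype.subsetP => l; rewrite !inE; exact: tr.
  by exists j; rewrite !inE ?ij ?irr.
have ltAn i : (#|A i| < n)%N.
  rewrite -[X in (_ < X)%N]card_ord -cardsT; apply: proper_card.
  by apply/properP; split; [exact: finset.subsetT|exists i; rewrite ?inE ?irr].
pose rk i : 'I_n := Ordinal (ltAn i).
have rk_inj : injective rk.
  move=> i j /(congr1 val) /= ij; apply/eqP; apply: contraT => /tot /orP[]/lt_card;
  by rewrite ij ltnn.
have -> : topk g k = rk @^-1: [set j : 'I_n | (j < k)%N]%SET.
  by apply/finset.setP => i; rewrite in_topk !finset.inE.
rewrite card_preimset// -sum1dep_card -(big_ord_widen _ (fun=> 1%N))//.
by rewrite sum1_card card_ord.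
Qed.

(** An active index at or below [x] would be beaten by all the indices above [x], of which there are
    at least [k]. *)
Lemma topk_gt {R : realType} {n : nat} (g : 'I_n -> 'I_n -> R) (k : nat) (x : R)
    (i : 'I_n) :
  (k <= #|[set j | (x < g j j)%R]%SET|)%N -> i \in topk g k -> x < g i i.
Proof.
rewrite in_topk => kx ik; rewrite ltNge; apply/negP => gx.
suff : (#|[set j | (x < g j j)%R]%SET| < k)%N by rewrite ltnNge kx.
apply: leq_ltn_trans ik; apply: subset_leq_card; apply/fintype.subsetP => j.
by rewrite !finset.inE => xj; rewrite /beats (le_lt_trans gx xj).
Qed.

(** The deterministic core: [x] separates the direct powers of the active pairs from their scaled
    interference, so success coincides with being active. *)
Lemma throughput_topk {R : realType} {n : nat} (g : 'I_n -> 'I_n -> R)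
    (N0 beta x : R) (k : nat) :
  (k <= #|[set j | (x < g j j)%R]%SET|)%N ->
  (forall i, i \in topk g k ->
    beta * (N0 + \sum_(j in topk g k | j != i) g j i) <= x) ->
  throughput g N0 beta (topk g k) = k.
Proof.
move=> kx H; rewrite -[RHS](@card_topk _ _ g); last first.
  by apply: leq_trans kx _; rewrite -[X in (_ <= X)%N]card_ord max_card.
rewrite /throughput card_classical; apply: eq_card => i.
rewrite finset.inE /success.
case ik : (i \in topk g k) => //=.
by rewrite (le_lt_trans (H i ik))// (topk_gt _ k).
Qed.

(** * Measurability of the selection and of the throughput *)

Lemma measurable_fset_event {d : measure_display} {T : measurableType d}
    {I : finType} (S : T -> {set I}) (Q : {set I} -> Prop) :
  (forall i, measurable [set t | i \in S t]) -> measurable [set t | Q (S t)].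
Proof.
move=> mS.
have mE s : measurable [set t | S t = s].
  have -> : [set t | S t = s] = \bigcap_(i in [set: I])
      (if i \in s then [set t | i \in S t] else ~` [set t | i \in S t]).
    apply/seteqP; split => [t <- i _|t H]; first by case: ifP => //= /negbT/negP.
    apply/finset.setP => i; have := H i Logic.I.
    by case: ifP => //= _ /negP/negbTE.
  apply: fin_bigcap_measurable; first exact: finite_finset.
  by move=> i _; case: ifP => // _; exact: measurableC.
have -> : [set t | Q (S t)] = \bigcup_(s in [set s | Q s]) [set t | S t = s].
  by apply/seteqP; split => [t Qt|t [s Qs /= -> //]]; exists (S t).
by apply: fin_bigcup_measurable; first exact: finite_finset.
Qed.

Lemma measurable_ltr_event {d : measure_display} {T : measurableType d}
    {R : realType} (f g : T -> R) :
  measurable_fun setT f -> measurable_fun setT g ->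
  measurable [set t | f t < g t].
Proof.
move=> mf mg; have := measurable_fun_ltr mf mg.
move=> /(_ measurableT [set true]); rewrite setTI; apply.
by [].
Qed.

(** Only the diagonal is assumed measurable, so that the result also applies when [T] carries the
    sigma-algebra generated by the direct links. *)
Lemma measurable_in_topk {d : measure_display} {T : measurableType d}
    {R : realType} {n : nat} (gam : 'I_n -> 'I_n -> T -> R) (k : nat) (i : 'I_n) :
  (forall j, measurable_fun setT (gam j j)) ->
  measurable [set t | i \in topk (fun a b => gam a b t) k].
Proof.
move=> mg.
under eq_set do rewrite in_topk.
apply: (measurable_fset_event _ (fun s => is_true (#|s| < k)%N)) => j.
under eq_set do rewrite finset.inE.
have -> : [set t | beats (fun a b => gam a b t) j i] =
    [set t | gam i i t < gam j j t] `|`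
    (~` [set t | gam i i t < gam j j t] `&` ~` [set t | gam j j t < gam i i t] `&`
     [set _ | (j < i)%N]).
  apply/seteqP; split => t; rewrite /beats /=.
    case: ltgtP => //= _; first by left.
    by move=> ji; right; split => //; split.
  by case: ltgtP => //= _ [//|[[]]//].
have mlt a b : measurable [set t | gam a a t < gam b b t].
  exact: measurable_ltr_event.
apply: measurableU => //; apply: measurableI.
  by apply: measurableI; exact: measurableC.
by case: (_ < _)%N; rewrite ?set_true ?set_false.
Qed.

Lemma measurable_throughput_topk {d : measure_display} {T : measurableType d}
    {R : realType} {n : nat} (gam : 'I_n -> 'I_n -> T -> R) (N0 beta : R)
    (k : nat) (Q : nat -> Prop) :
  (forall i j, measurable_fun setT (gam i j)) ->
  measurable [set t | Q (throughput (fun a b => gam a b t) N0 beta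
                          (topk (fun a b => gam a b t) k))].
Proof.
move=> mg; under eq_set do rewrite /throughput card_classical.
apply: (measurable_fset_event _ (fun s => Q #|s|)) => i.
under eq_set do rewrite finset.inE.
(* Splitting along the finitely many values of the random active set leaves success for a fixed
   set. *)
have -> : [set t | success (fun a b => gam a b t) N0 beta
                     (topk (fun a b => gam a b t) k) i] =
    \bigcup_(s in [set: {set 'I_n}])
      ([set t | topk (fun a b => gam a b t) k = s] `&`
       [set t | success (fun a b => gam a b t) N0 beta s i]).
  apply/seteqP; split => [t Ht|t [s _ [/= <- //]]].
  by exists (topk (fun a b => gam a b t) k).
apply: fin_bigcup_measurable; first exact: finite_finset.
move=> s _; apply: measurableI.
  apply: (measurable_fset_event _ (fun u => u = s)) => j.
  exact: measurable_in_topk.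
rewrite /success; case: (i \in s) => //=; last by rewrite set_false.
apply: measurable_ltr_event => //; apply: measurable_funM => //.
apply: measurable_funD => //.
by under eq_fun do rewrite -big_filter; exact: measurable_sum.
Qed.

Lemma measurable_fun_cylinders {d : measure_display} {T : measurableType d}
    {R : realType} {I : finType} (X : I -> T -> R) (J : pred I) (i : I) :
  J i -> measurable_fun setT (X i : g_sigma_algebraType (cylinders X J) -> R).
Proof.
move=> Ji _ B mB; rewrite setTI; apply: sub_sigma_algebra.
exists (fun j => if j == i then B else setT); first by move=> j; case: ifP.
apply/seteqP; split => [t Bt j _|t /(_ i Ji)]; last by rewrite /= eqxx.
by rewrite /=; case: eqP => // ->.
Qed.

(** * Chernoff bounds *)

(** Exponential Markov inequality: on the event, [expR (theta * (sum - y))] is at least 1, and its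
    expectation against [\1_D] factorises by [expectation_prod_sigma]. *)
Lemma chernoff_sigma {d : measure_display} {T : measurableType d}
    {R : realType} (P : probability T R) {I : finType} (X : I -> T -> R)
    (J : pred I) (D : set T) (r : seq I) (theta M y : R) :
  mutually_independent P X -> (forall i, measurable_fun setT (X i)) ->
  <<s cylinders X J >> D -> uniq r -> (forall i, i \in r -> ~~ J i) ->
  0 <= theta -> (forall i, \int[P]_t (expR (theta * X i t))%R%:E = M%:E)%E ->
  (P (D `&` [set t | (y < \sum_(i <- r) X i t)%R]) <=
   P D * (expR (- (theta * y)) * M ^+ size r)%R%:E)%E.
Proof.
move=> indX mX sD ur rJ th0 XM.
have mD : measurable D.
  apply: (smallest_sub (@sigma_algebra_measurable _ T) _) sD.
  by move=> _ [B mB ->]; exact: measurable_cylinder.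
have mA : measurable [set t | y < \sum_(i <- r) X i t].
  by apply: measurable_ltr_event => //; exact: measurable_sum.
have mexp : measurable_fun setT (fun x : R => expR (theta * x)).
  by apply: measurableT_comp => //; exact: measurable_funM.
have mprod : measurable_fun setT (fun t => \prod_(i <- r) expR (theta * X i t)).
  apply: measurable_prod => i _.
  exact: (measurableT_comp mexp (mX i)).
rewrite -[X in P X]setIT -integral_indic//; last exact: measurableI.
apply: (@le_trans _ _ (\int[P]_t ((expR (- (theta * y)))%R%:E *
    (\1_D t * \prod_(i <- r) expR (theta * X i t))%R%:E))%E).
  apply: ge0_le_integral => //.
  - by apply/measurable_EFinP; apply: measurable_indic; exact: measurableI.
  - apply/measurable_EFinP; apply: measurable_funM => //.
    by apply: measurable_funM => //; exact: measurable_indic.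
  move=> t _; rewrite -EFinM lee_fin indicI mulrCA ler_wpM2l//.
  rewrite -expR_sum -expRD -mulr_sumr -mulrN -mulrDr.
  rewrite indicE; case: (boolP (t \in _)) => [/set_mem /= yt|_];
    last exact: expR_ge0.
  by rewrite -expR0 ler_expR mulr_ge0// addrC subr_ge0 ltW.
rewrite ge0_integralZl//; last 2 first.
- by apply/measurable_EFinP; apply: measurable_funM => //; exact: measurable_indic.
- move=> t _; rewrite lee_fin mulr_ge0//.
  by rewrite prodr_ge0// => i _; exact: expR_ge0.
have := expectation_prod_sigma P X J D r (fun=> fun x => expR (theta * x))
  (fun=> M) indX mX sD ur rJ (fun=> mexp) (fun _ _ => expR_ge0 _) XM.
by rewrite /= big_const_seq count_predT iter_mulr_1 => ->; rewrite muleCA EFinM.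
Qed.

(** With N the number of direct links above [x], the expectation of [2 ^- N] is [(1 - p / 2) ^+ n],
    and [2 ^ (k - N)] is at least 1 when N < k; Markov's inequality concludes. *)
Lemma few_exceedances {d : measure_display} {T : measurableType d}
    {R : realType} (P : probability T R) {n : nat}
    (gam : 'I_n -> 'I_n -> T -> R) (x p : R) (k : nat) :
  mutually_independent P (fun ij : 'I_n * 'I_n => gam ij.1 ij.2) ->
  (forall i j, measurable_fun setT (gam i j)) ->
  (forall i j, P [set t | x < gam i j t] = p%:E) ->
  (P [set t | (#|[set j | (x < gam j j t)%R]%SET| < k)%N] <=
   (2 ^+ k * (1 - p / 2) ^+ n)%R%:E)%E.
Proof.
move=> indX mg Pp.
(* The product of [f] over the direct links is [2 ^- N]. *)
pose f (y : R) : R := if x < y then 2^-1 else 1.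
have fE y : f y = 2^-1 * \1_(`]x, +oo[%classic) y + \1_(~` `]x, +oo[%classic) y.
  rewrite /f !indicE in_setC mem_setE in_itv /= andbT.
  by case: (x < y); rewrite /= ?mulr1 ?mulr0 ?addr0 ?add0r.
have f0 y : 0 <= f y by rewrite /f; case: ifP.
have mf : measurable_fun setT f.
  rewrite (_ : f = fun y => 2^-1 * \1_(`]x, +oo[%classic) y +
                           \1_(~` `]x, +oo[%classic) y); last exact/funext.
  apply: measurable_funD; last by apply: measurable_indic; exact: measurableC.
  by apply: measurable_funM => //; exact: measurable_indic.
have mA i j : measurable [set t | x < gam i j t] by exact: measurable_ltr_event.
have intf i j : (\int[P]_t (f (gam i j t))%:E = (1 - p / 2)%:E)%E.
  have -> : (\int[P]_t (f (gam i j t))%:E =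
     \int[P]_t ((2^-1)%:E * (\1_[set t | (x < gam i j t)%R] t)%:E +
                (\1_(~` [set t | (x < gam i j t)%R]) t)%:E))%E.
    apply: eq_integral => t _; rewrite -EFinM -EFinD fE; congr (_%:E).
    rewrite !indicE !in_setC !mem_setE in_itv /= andbT.
    congr (_ * _%:R + (~~ _)%:R); by apply/esym/asboolb.
  rewrite ge0_integralD//; last 2 first.
  - apply/measurable_EFinP; apply: measurable_funM => //; exact: measurable_indic.
  - by apply/measurable_EFinP; apply: measurable_indic; exact: measurableC.
  rewrite ge0_integralZl_EFin//; last first.
    by apply/measurable_EFinP; exact: measurable_indic.
  rewrite !integral_indic ?setIT//; last exact: measurableC.
  transitivity ((2^-1)%:E * P [set t | (x < gam i j t)%R] +
                (1 - P [set t | (x < gam i j t)%R]))%E.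
    congr (_ + _)%E; exact: probability_setC.
  by rewrite Pp -EFinM -EFinB -EFinD; congr (_%:E); lra.
pose r : seq ('I_n * 'I_n) := [seq (i, i) | i <- enum 'I_n].
have ur : uniq r by rewrite map_inj_uniq ?enum_uniq// => i j [].
(* No conditioning is wanted here: the event is the whole space and no coordinate is set aside. *)
have sT : <<s cylinders (fun ij : 'I_n * 'I_n => gam ij.1 ij.2) pred0 >> setT.
  exact: (@measurableT _ (g_sigma_algebraType _)).
have := expectation_prod_sigma P _ pred0 _ r (fun=> f) (fun=> 1 - p / 2) indX
  (fun ij => mg ij.1 ij.2) sT ur (fun _ _ => erefl) (fun=> mf) (fun=> f0)
  (fun ij => intf ij.1 ij.2).
rewrite probability_setT mul1e big_const_seq count_predT iter_mulr_1.
rewrite size_map size_enum_ord => Ef.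
have mN : measurable [set t | (#|[set j | (x < gam j j t)%R]%SET| < k)%N].
  apply: (measurable_fset_event _ (fun s => is_true (#|s| < k)%N)) => j.
  by under eq_set do rewrite finset.inE.
have mprod : measurable_fun setT (fun t => \prod_(i <- r) f (gam i.1 i.2 t)).
  by apply: measurable_prod => i _; exact: measurableT_comp.
rewrite EFinM -Ef -ge0_integralZl//; last 2 first.
- by apply/measurable_EFinP; apply: measurable_funM => //; exact: measurable_indic.
- by move=> t _; rewrite lee_fin mulr_ge0// prodr_ge0.
rewrite -[X in P X]setIT -integral_indic//.
apply: ge0_le_integral => //.
- by apply/measurable_EFinP; exact: measurable_indic.
- apply/measurable_EFinP; apply: measurable_funM => //.
  by apply: measurable_funM => //; exact: measurable_indic.
move=> t _; rewrite -EFinM lee_fin indicT mul1r big_map big_enum /=.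
have -> : \prod_i f (gam i i t) = 2^-1 ^+ #|[set j | (x < gam j j t)%R]%SET|.
  rewrite -prodr_const [RHS]big_mkcond /=; apply: eq_bigr => i _.
  by rewrite finset.inE.
rewrite indicE; case: (boolP (t \in _)) => [/set_mem /= Nk|_];
  last by rewrite mulr_ge0.
rewrite -(subnK (ltnW Nk)) exprD -mulrA exprVn mulfV ?expf_neq0// mulr1.
by rewrite exprn_ege1// ler1n.
Qed.

(** * Interference at the active destinations *)

Lemma measure_bigsetU_le {d : measure_display} {T : measurableType d}
    {R : realType} (mu : {measure set T -> \bar R}) {I : Type} (r : seq I)
    (Q : pred I) (A : I -> set T) :
  (forall i, measurable (A i)) ->
  (mu (\big[setU/set0]_(i <- r | Q i) A i) <= \sum_(i <- r | Q i) mu (A i))%E.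
Proof.
move=> mA; elim: r => [|i r IH]; first by rewrite !big_nil measure0.
rewrite !big_cons; case: ifP => // _.
apply: le_trans (leeD2l _ IH).
by apply: measureU2 => //; exact: bigsetU_measurable.
Qed.

Lemma sum_probability_fibers {d : measure_display} {T : measurableType d}
    {R : realType} (P : probability T R) {F : finType} (S : T -> F) :
  (forall s, measurable [set t | S t = s]) ->
  (\sum_(s : F) P [set t | S t = s] = 1)%E.
Proof.
move=> mS.
transitivity (\int[P]_t (\sum_(s : F) (\1_[set t | S t = s] t)%:E))%E.
  rewrite ge0_integral_sum//; last first.
    by move=> s; apply/measurable_EFinP; exact: measurable_indic.
  by apply: eq_bigr => s _; rewrite integral_indic ?setIT.
transitivity (\int[P]_t (cst 1 t))%E; last first.
  by rewrite integral_cst// mul1e; exact: probability_setT.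
apply: eq_integral => t _; rewrite (bigD1 (S t))//= big1 ?adde0.
  by rewrite indicE mem_set.
by move=> s sS; rewrite indicE memNset//= => /esym/eqP; exact/negP.
Qed.

(** The event that the active set equals [s] depends on the direct links, the interference within
    [s] on cross links only, so [chernoff_sigma] applies for each [s] and each [i] in [s]. Summing
    over the [k] members of [s] gives the factor [k], and the probabilities of the values [s] add up
    to 1. *)
Lemma interference_topk {d : measure_display} {T : measurableType d}
    {R : realType} (P : probability T R) {n : nat}
    (gam : 'I_n -> 'I_n -> T -> R) (theta M0 M y : R) (k : nat) :
  mutually_independent P (fun ij : 'I_n * 'I_n => gam ij.1 ij.2) ->
  (forall i j, measurable_fun setT (gam i j)) ->
  0 <= theta -> 0 <= M0 <= M -> 1 <= M -> (k <= n)%N ->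
  (forall i j, \int[P]_t (expR (theta * gam i j t))%R%:E = M0%:E)%E ->
  let S t := topk (fun a b => gam a b t) k in
  let bad := \big[setU/set0]_(s : {set 'I_n}) \big[setU/set0]_(i in s)
    ([set t | S t = s] `&`
     [set t | y < \sum_(j in s | j != i) gam j i t]) in
  measurable bad /\ (P bad <= (k%:R * (expR (- (theta * y)) * M ^+ k))%R%:E)%E.
Proof.
move=> indX mg th0 /andP[M00 M0M] M1 kn XM S bad.
pose X (ij : 'I_n * 'I_n) := gam ij.1 ij.2.
pose J : pred ('I_n * 'I_n) := fun ij => ij.1 == ij.2.
have sS s : <<s cylinders X J >> [set t | S t = s].
  apply: (@measurable_fset_event _ (g_sigma_algebraType (cylinders X J))
    _ S (fun u => u = s)) => i.
  apply: (@measurable_in_topk _ (g_sigma_algebraType (cylinders X J))) => j.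
  by apply: (measurable_fun_cylinders X J (j, j)); rewrite /J /=.
have mS s : measurable [set t | S t = s].
  apply: (measurable_fset_event S (fun u => u = s)) => i.
  exact: measurable_in_topk.
have mA s i : measurable ([set t | S t = s] `&`
    [set t | y < \sum_(j in s | j != i) gam j i t]).
  apply: measurableI => //; apply: measurable_ltr_event => //.
  by under eq_fun do rewrite -big_filter; exact: measurable_sum.
have mU (s : {set 'I_n}) : measurable (\big[setU/set0]_(i in s)
    ([set t | S t = s] `&` [set t | y < \sum_(j in s | j != i) gam j i t])).
  exact: bigsetU_measurable.
split; first exact: bigsetU_measurable.
have E0 : 0 <= expR (- (theta * y)) * M ^+ k.
  by rewrite mulr_ge0 ?expR_ge0// exprn_ge0// (le_trans ler01 M1).
apply: (le_trans (measure_bigsetU_le P _ _ _ mU)).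
rewrite -[leRHS]mul1e -(sum_probability_fibers P S mS) ge0_sume_distrl//.
apply: lee_sum => s _.
(* By [card_topk], a set whose cardinal is not [k] is never selected. *)
have [sk|sk] := eqVneq #|s| k; last first.
  rewrite (_ : [set t | S t = s] = set0); last first.
    rewrite -subset0 => t /= Sts; move/eqP: sk; apply.
    by rewrite -Sts card_topk.
  rewrite measure0 mul0e big1 ?measure0// => i _.
  by rewrite set0I.
apply: (le_trans (measure_bigsetU_le P _ _ _ (mA s))).
apply: (@le_trans _ _ (\sum_(i in s) (P [set t | S t = s] *
    (expR (- (theta * y)) * M ^+ k)%R%:E))%E).
  apply: lee_sum => i si.
  pose r := [seq (j, i) | j <- index_enum ('I_n) & (j \in s) && (j != i)].
  have ur : uniq r.
    by rewrite map_inj_uniq ?filter_uniq ?index_enum_uniq// => a b [].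
  have rJ ij : ij \in r -> ~~ J ij.
    by move=> /mapP[j]; rewrite mem_filter => /andP[/andP[_ ji] _] ->.
  have -> : [set t | y < \sum_(j in s | j != i) gam j i t] =
            [set t | y < \sum_(ij <- r) X ij t].
    by under [RHS]eq_set do rewrite big_map big_filter.
  apply: le_trans (chernoff_sigma P X J _ _ _ M0 y indX (fun ij => mg ij.1 ij.2)
    (sS s) ur rJ th0 (fun ij => XM ij.1 ij.2)) _.
  rewrite lee_wpmul2l// lee_fin ler_wpM2l ?expR_ge0//.
  (* [M0] may be below 1, so it is replaced by [M] before the exponent is raised from [size r] to
     [k]. *)
  apply: (@le_trans _ _ (M ^+ size r)).
    by rewrite lerXn2r// nnegrE (le_trans M00).
  rewrite ler_weXn2l//.
  rewrite size_map size_filter -sk -sum1_card -sum1_count.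
  rewrite [leqRHS]big_mkcond [leqLHS]big_mkcond leq_sum// => j _.
  by case: (j \in s); case: (_ == _).
have -> : P [set t | S t = s] = (fine (P [set t | S t = s]))%:E.
  by rewrite fineK// fin_num_measure.
rewrite sumEFin sumr_const sk -EFinM lee_fin.
by rewrite -[leLHS]mulr_natl mulrCA lexx.
Qed.

(** * The Nakagami density *)

Lemma nakagami_pdf_ge0 {R : realType} (m Om x : R) : 0 <= nakagami_pdf m Om x.
Proof.
rewrite /nakagami_pdf; case: ifP => // _.
rewrite divr_ge0// mulr_ge0 ?powR_ge0 ?expR_ge0// fine_ge0// integral_ge0//.
by move=> y _; rewrite lee_fin mulr_ge0 ?powR_ge0 ?expR_ge0.
Qed.

Lemma measurable_nakagami_pdf {R : realType} (m Om : R) :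
  measurable_fun setT (nakagami_pdf m Om).
Proof.
apply: measurable_fun_ifT => //; first exact: measurable_fun_ler.
apply: measurable_funM => //; apply: measurable_funM; first exact: measurable_powR.
apply: measurableT_comp => //; apply: measurableT_comp => //.
apply: measurable_funM => //; exact: measurable_funM.
Qed.

(** The constant is nonnegative; were it zero, division by zero yielding zero would make the density
    vanish, against total mass 1. No evaluation of [Gammaf] is involved. *)
Lemma nakagami_norm_gt0 {R : realType} (m Om : R) :
  (\int[@lebesgue_measure R]_x (nakagami_pdf m Om x)%:E = 1)%E ->
  0 < Gammaf m * powR (Om / m) m.
Proof.
move=> int1; rewrite lt_neqAle; apply/andP; split; last first.
  rewrite mulr_ge0 ?powR_ge0// fine_ge0// integral_ge0//.
  by move=> y _; rewrite lee_fin mulr_ge0 ?powR_ge0 ?expR_ge0.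
apply/eqP => K0; move: int1.
rewrite integral0_eq; first by move=> /eqP; rewrite eqe eq_sym oner_eq0.
by move=> x _; rewrite /nakagami_pdf -K0 invr0 mulr0 if_same.
Qed.

Lemma nakagami_tail {R : realType} (m Om x : R) : 0 < m -> 0 < Om -> 1 <= x ->
  ((expR (- ((`|m - 1| + m / Om) * (x + 1))) / (Gammaf m * powR (Om / m) m))%R%:E <=
   \int[@lebesgue_measure R]_(y in `]x, +oo[%classic) (nakagami_pdf m Om y)%:E)%E.
Proof.
move=> m0 Om0 x1; set K := Gammaf m * _; set c := expR _ / K.
have K0 : 0 <= K.
  rewrite mulr_ge0 ?powR_ge0// fine_ge0// integral_ge0//.
  by move=> y _; rewrite lee_fin mulr_ge0 ?powR_ge0 ?expR_ge0.
have mpdf (D : set R) : measurable_fun D (EFin \o nakagami_pdf m Om).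
  apply: measurable_funTS; apply/measurable_EFinP.
  exact: measurable_nakagami_pdf.
apply: (@le_trans _ _
  (\int[@lebesgue_measure R]_(y in `]x, (x + 1)%R]%classic)
     (nakagami_pdf m Om y)%:E)%E).
  rewrite [leLHS](_ : _ =
    \int[@lebesgue_measure R]_(y in `]x, (x + 1)%R]%classic) (cst c%:E y))%E.
    apply: ge0_le_integral => //.
    - by move=> y _; rewrite lee_fin divr_ge0 ?expR_ge0.
    - exact: mpdf.
    - move=> y /=; rewrite in_itv /= => /andP[xy yx].
      have y1 : 1 < y := le_lt_trans x1 xy.
      have y0 : 0 < y := lt_trans ltr01 y1.
      rewrite lee_fin /nakagami_pdf (ltW y0) -/K ler_wpM2r ?invr_ge0//.
      rewrite /powR (gt_eqF y0) -expRD ler_expR.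
      have lny : ln y <= y by exact/ltW/ln_sublinear.
      have lny0 : 0 <= ln y by exact/ln_ge0/ltW.
      have A : - (`|m - 1| * (x + 1)) <= (m - 1) * ln y.
        rewrite lerNl -mulNr (le_trans (ler_norm _))//.
        by rewrite normrM normrN ler_pM// ger0_norm// (le_trans lny).
      have B : m * y / Om <= m / Om * (x + 1).
        by rewrite mulrAC ler_wpM2l// divr_ge0// ltW.
      by rewrite mulrDl opprD lerD// lerN2.
  rewrite integral_cst//= lebesgue_measure_itv/= lte_fin ltrDl ltr01.
  by rewrite -EFinB addrAC subrr add0r mule1.
apply: ge0_subset_integral => //.
- exact: mpdf.
- by move=> y _; rewrite lee_fin nakagami_pdf_ge0.
- by move=> y /=; rewrite !in_itv /= andbT => /andP[].
Qed.

(** The exponent is half the decay rate of the density. Up to 1 the integrand is dominated by a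
    multiple of the density; beyond 1 the power of [x] is absorbed by half of the remaining decay,
    leaving a multiple of an exponential density. *)
Lemma nakagami_mgf {R : realType} (m Om : R) : 0 < m -> 0 < Om ->
  (\int[@lebesgue_measure R]_x (nakagami_pdf m Om x)%:E = 1)%E ->
  (\int[@lebesgue_measure R]_x
     (expR (m / Om / 2 * x) * nakagami_pdf m Om x)%R%:E < +oo)%E.
Proof.
move=> m0 Om0 int1; have := nakagami_norm_gt0 _ _ int1.
set K := Gammaf m * _ => K0.
set th := m / Om / 2.
have th0 : 0 < th by rewrite !divr_gt0.
(* Chosen so that [|m - 1| * eps <= th / 2]; the added 1 keeps the denominator positive when
   [m = 1]. *)
pose eps := th / 2 / (`|m - 1| + 1).
have n1 : 0 < `|m - 1| + 1 by rewrite ltr_wpDl.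
have eps0 : 0 < eps by rewrite !divr_gt0.
pose C := expR (- (`|m - 1| * ln eps)) / (K * (th / 2)).
have C0 : 0 <= C by rewrite divr_ge0 ?expR_ge0// mulr_ge0// ltW// divr_gt0.
have mpdf : measurable_fun setT (EFin \o nakagami_pdf m Om).
  by apply/measurable_EFinP; exact: measurable_nakagami_pdf.
have mexp : measurable_fun setT (EFin \o exponential_pdf (th / 2)).
  by apply/measurable_EFinP; exact: measurable_exponential_pdf.
have pdf0 x : 0 <= nakagami_pdf m Om x := nakagami_pdf_ge0 m Om x.
have epdf0 x : 0 <= exponential_pdf (th / 2) x.
  by apply: exponential_pdf_ge0; rewrite ltW// divr_gt0.
apply: (@le_lt_trans _ _ (\int[@lebesgue_measure R]_x
    ((expR th)%:E * (nakagami_pdf m Om x)%:E +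
     C%:E * (exponential_pdf (th / 2) x)%:E))%E).
  apply: ge0_le_integral => //.
  - by move=> x _; rewrite lee_fin mulr_ge0 ?expR_ge0.
  - apply/measurable_EFinP; apply: measurable_funM;
      last exact: measurable_nakagami_pdf.
    by apply: measurableT_comp => //; exact: measurable_funM.
  - by apply: emeasurable_funD; apply: emeasurable_funM.
  move=> x _; rewrite -!EFinM -EFinD lee_fin.
  have [x1|x1] := leP x 1.
    apply: ler_wpDr; first exact: mulr_ge0.
    rewrite ler_wpM2r// ler_expR.
    by rewrite -[leRHS]mulr1 ler_wpM2l// ltW.
  have x0 : 0 < x := lt_trans ltr01 x1.
  apply: ler_wpDl; first by rewrite mulr_ge0 ?expR_ge0.
  rewrite exponential_pdfE ?(ltW x0)//.
  rewrite /nakagami_pdf (ltW x0) -/K.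
  have -> : C * (th / 2 * expR (- (th / 2) * x)) =
      expR (- (`|m - 1| * ln eps) + - (th / 2) * x) / K.
    rewrite /C expRD invfM; field.
    by rewrite !gt_eqF.
  rewrite !mulrA ler_wpM2r ?invr_ge0 ?(ltW K0)//.
  rewrite /powR (gt_eqF x0) -!expRD ler_expR.
  have lnx0 : 0 <= ln x by exact/ln_ge0/ltW.
  (* This is [ln (eps * x) <= eps * x]. *)
  have lnx : ln x <= eps * x - ln eps.
    rewrite lerBrDr -lnM ?posrE// mulrC; apply/ltW/ln_sublinear.
    exact: mulr_gt0.
  have A : (m - 1) * ln x <= `|m - 1| * (eps * x - ln eps).
    rewrite (le_trans (ler_norm _))// normrM ler_wpM2l// ger0_norm//.
  have B : `|m - 1| * (eps * x) <= th / 2 * x.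
    rewrite mulrA ler_wpM2r ?(ltW x0)// /eps mulrCA.
    apply: ler_piMr; first by rewrite divr_ge0// ltW.
    by rewrite ler_pdivrMr// mul1r lerDl.
  have D : m * x / Om = 2 * th * x.
    rewrite /th; field; exact: lt0r_neq0.
  rewrite D; lra.
rewrite ge0_integralD//; last 4 first.
- by move=> x _; rewrite -EFinM lee_fin mulr_ge0 ?expR_ge0.
- exact: emeasurable_funM.
- by move=> x _; rewrite -EFinM lee_fin mulr_ge0.
- exact: emeasurable_funM.
rewrite !ge0_integralZl//; last 2 first.
- by move=> x _; rewrite lee_fin.
- by move=> x _; rewrite lee_fin.
by rewrite int1 integral_exponential_pdf ?divr_gt0// !mule1 -EFinD ltry.
Qed.

(** Instance of [eq_integral_weight] with weight 1 under [P] and weight [pdf] under Lebesgue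
    measure; the indicator case is [has_density] itself. *)
Lemma integral_density {d : measure_display} {T : measurableType d}
    {R : realType} (P : probability T R) (X : T -> R) (pdf f : R -> R) :
  has_density P X pdf -> measurable_fun setT pdf -> (forall x, 0 <= pdf x) ->
  measurable_fun setT f -> (forall x, 0 <= f x) ->
  (\int[P]_t (f (X t))%:E =
   \int[@lebesgue_measure R]_x (f x * pdf x)%:E)%E.
Proof.
move=> [mX dX] mpdf pdf0 mf f0.
transitivity (\int[P]_t (f (X t) * 1)%:E)%E.
  by apply: eq_integral => t _; rewrite mulr1.
apply: (eq_integral_weight P lebesgue_measure X (fun=> 1) id pdf) => // B mB.
have mXB : measurable (X @^-1` B) by rewrite -[X in measurable X]setTI; exact: mX.
transitivity (P (X @^-1` B)).
  rewrite -[X in P X]setIT -integral_indic//.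
  by apply: eq_integral => t _; rewrite mulr1.
rewrite dX// [LHS]integral_mkcond.
apply: eq_integral => x _.
rewrite patchE indicE; case: ifP => // _; first by rewrite mul1r.
by rewrite mul0r.
Qed.

(** * Asymptotics *)

Lemma throughput_topk_prob {d : measure_display} {T : measurableType d}
    {R : realType} (P : probability T R) {n : nat}
    (gam : 'I_n -> 'I_n -> T -> R) (N0 beta theta M0 M x p : R) (k : nat)
    (Q : nat -> Prop) :
  mutually_independent P (fun ij : 'I_n * 'I_n => gam ij.1 ij.2) ->
  (forall i j, measurable_fun setT (gam i j)) ->
  (forall i j, P [set t | x < gam i j t] = p%:E) ->
  (forall i j, \int[P]_t (expR (theta * gam i j t))%R%:E = M0%:E)%E ->
  0 < beta -> 0 <= theta -> 0 <= M0 <= M -> 1 <= M -> (k <= n)%N -> Q k ->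
  1 - (2 ^+ k * (1 - p / 2) ^+ n +
       k%:R * (expR (- (theta * (x / beta - N0))) * M ^+ k)) <=
  fine (P [set t | Q (throughput (fun i j => gam i j t) N0 beta
                       (topk (fun i j => gam i j t) k))]).
Proof.
move=> indX mg Pp XM b0 th0 M0M M1 kn Qk.
set A := [set t | Q _].
have mA : measurable A by exact: measurable_throughput_topk.
pose few := [set t | (#|[set j | (x < gam j j t)%R]%SET| < k)%N].
have Pfew : (P few <= (2 ^+ k * (1 - p / 2) ^+ n)%R%:E)%E.
  exact: few_exceedances.
have mfew : measurable few.
  apply: (measurable_fset_event _ (fun s => is_true (#|s| < k)%N)) => j.
  by under eq_set do rewrite finset.inE; exact: measurable_ltr_event.
have [] := interference_topk P gam theta M0 M (x / beta - N0) k indX mg th0 M0M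
  M1 kn XM.
set bad := \big[_/_]_(_ : _) _ => mbad Pbad.
(* Outside both exceptional events [throughput_topk] gives throughput exactly [k], for which [Q]
   holds. *)
have sub : ~` A `<=` few `|` bad.
  move=> t /= nQ; have [fewt|kt] := ltnP #|[set j | (x < gam j j t)%R]%SET| k.
    by left.
  right; apply: contrapT => nbad; apply: nQ.
  rewrite /A /= (throughput_topk _ _ _ x)// => i it.
  rewrite mulrC -ler_pdivlMr// addrC -lerBrDr leNgt; apply/negP => yt.
  apply: nbad; rewrite /bad.
  rewrite -bigcup_seq_cond; exists (topk (fun a b => gam a b t) k).
    by rewrite /= mem_index_enum.
  by rewrite -bigcup_seq_cond; exists i; rewrite /= ?mem_index_enum ?it.
have PAC : (P (~` A) <= (2 ^+ k * (1 - p / 2) ^+ n +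
    k%:R * (expR (- (theta * (x / beta - N0))) * M ^+ k))%R%:E)%E.
  apply: (@le_trans _ _ (P (few `|` bad))).
    by apply: le_measure; rewrite ?inE//; [exact: measurableC|exact: measurableU].
  rewrite EFinD; apply: le_trans (leeD Pfew Pbad).
  exact: measureU2.
have PCE := probability_setC P mA.
have PA : P A = (fine (P A))%:E by rewrite fineK// fin_num_measure.
move: PAC; rewrite PCE PA -EFinB lee_fin => PAC.
lra.
Qed.

(** For [u >= 1] the linear factor is at most [(al + ga) * u], whereas [expR (de * u)] is at least
    [(de * u) ^+ 2 / 2]; the quotient is of order [1 / u]. *)
Lemma linear_expR_le {R : realType} (al ga de e : R) :
  0 <= al -> 0 <= ga -> 0 < de -> 0 < e ->
  exists U : R, forall u, U <= u -> (al * u + ga) * expR (- (de * u)) <= e.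
Proof.
move=> al0 ga0 de0 e0; exists (Num.max 1 (2 * (al + ga) / (de ^+ 2 * e))) => u.
rewrite ge_max => /andP[u1 uU].
have u0 : 0 < u := lt_le_trans ltr01 u1.
have du0 : 0 < de * u by exact: mulr_gt0.
have h1 : al * u + ga <= (al + ga) * u.
  by rewrite mulrDl lerD2l ler_peMr.
have h2 : (de * u) ^+ 2 / 2 <= expR (de * u).
  apply: le_trans (expR_ge1Dxn 1 (ltW du0)).
  by rewrite ler_wpDl.
rewrite expRN ler_pdivrMr ?expR_gt0//.
apply: (le_trans h1).
apply: le_trans (_ : e * ((de * u) ^+ 2 / 2) <= _); last first.
  by rewrite ler_wpM2l// ltW.
move: uU; rewrite ler_pdivrMr; last by rewrite mulr_gt0// exprn_gt0.
move=> /(ler_wpM2r (ltW u0)); lra.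
Qed.

(** The left side is at most [expR (k - n * p / 2)]. Here [n * p] is at least [c1 * expR (L / 2)],
    so the last hypothesis makes [n * p / 2] at least [(kap + 1) * L + 1], hence at least
    [k + L]. *)
Lemma few_exceedances_bound {R : realType} (p c1 L kap : R) (n k : nat) :
  0 <= p <= 1 -> n%:R = expR L -> k%:R <= kap * L + 1 ->
  c1 * expR (- (2^-1 * L)) <= p ->
  ((kap + 1) * L + 1) * expR (- (2^-1 * L)) <= c1 / 2 ->
  2 ^+ k * (1 - p / 2) ^+ n <= expR (- L).
Proof.
move=> /andP[p0 p1] nL kL c1p Lc.
have h1 : 2 ^+ k <= expR (k%:R : R).
  rewrite -[X in expR X]mulr1 expRM_natl lerXn2r ?nnegrE ?expR_ge0//.
  by have := expR_ge1Dx (1 : R).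
have h2 : (1 - p / 2) ^+ n <= expR (n%:R * (- (p / 2))).
  rewrite expRM_natl lerXn2r ?nnegrE ?expR_ge0//; first lra.
  exact: expR_ge1Dx.
have q0 : 0 <= 1 - p / 2 by lra.
apply: (le_trans (ler_pM (exprn_ge0 _ _) (exprn_ge0 _ q0) h1 h2)) => //.
rewrite -expRD ler_expR nL.
have E2 : expR L = expR (2^-1 * L) * expR (2^-1 * L).
  by rewrite -expRD; congr expR; lra.
have EN : expR (- (2^-1 * L)) * expR (2^-1 * L) = 1.
  by rewrite -expRD addNr expR0.
have e0 := expR_gt0 (2^-1 * L).
move: (ler_wpM2r (ltW e0) c1p) (ler_wpM2r (ltW e0) Lc).
rewrite -!mulrA EN !mulr1 => h3 h4.
have h5 := ler_wpM2r (ltW e0) h3.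
rewrite E2; lra.
Qed.

(** [M ^+ k] is at most [M * expR (kap * ln M * L)], which by the choice of [kap] consumes only half
    of the decay rate [theta * b / beta]. *)
Lemma interference_bound {R : realType} (M kap L theta b beta N0 : R) (k : nat) :
  1 <= M -> kap * ln M = theta * b / beta / 2 -> k%:R <= kap * L + 1 ->
  k%:R * (expR (- (theta * (b * L / beta - N0))) * M ^+ k) <=
  (kap * L + 1) * (M * expR (theta * N0)) * expR (- (theta * b / beta / 2 * L)).
Proof.
move=> M1 kM kL; have M0 : 0 < M := lt_le_trans ltr01 M1.
rewrite -[leRHS]mulrA ler_pM ?mulr_ge0 ?expR_ge0 ?exprn_ge0 ?(ltW M0)//.
have -> : M ^+ k = expR (k%:R * ln M) by rewrite expRM_natl lnK.
have -> : M * expR (theta * N0) = expR (ln M + theta * N0) by rewrite expRD lnK.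
rewrite -!expRD ler_expR.
have := ler_wpM2r (ln_ge0 M1) kL; rewrite mulrDl mul1r mulrAC kM => h.
have -> : theta * (b * L / beta - N0) = theta * b / beta * L - theta * N0.
  by rewrite mulrBr !mulrA [theta * b * L / beta]mulrAC.
lra.
Qed.

Theorem corollary1 (R : realType) (m Om N0 beta : R)
  (hm : 0 < m) (hOm : 0 < Om) (hN0 : 0 <= N0) (hbeta : 0 < beta) :
  exists c : R, 0 < c /\
  exists k : nat -> nat,
  forall (d : measure_display) (T : measurableType d) (P : probability T R)
         (gam : forall n : nat, 'I_n -> 'I_n -> T -> R),
    (forall n, mutually_independent P
                 (fun ij : 'I_n * 'I_n => gam n ij.1 ij.2)) ->
    (forall n (i j : 'I_n), has_density P (gam n i j) (nakagami_pdf m Om)) ->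
    (fun n : nat =>
       fine (P [set t | c * ln (n%:R : R) <=
         (throughput (fun i j => gam n i j t) N0 beta
            (topk (fun i j => gam n i j t) (k n)))%:R])) @ \oo --> (1 : R).
Proof.
pose a := `|m - 1| + m / Om.
have a0 : 0 < a by rewrite ltr_wpDl// divr_gt0.
(* With [a] the rate in [nakagami_tail], [a * b] is 1/2, so the threshold [b * L] is exceeded with
   probability at least of order [n^(-1/2)]. *)
pose b := (2 * a)^-1.
have b0 : 0 < b by rewrite invr_gt0 mulr_gt0.
pose th := m / Om / 2.
have th0 : 0 < th by rewrite !divr_gt0.
pose mgf := (\int[@lebesgue_measure R]_x
  (expR (th * x) * nakagami_pdf m Om x)%R%:E)%E.
have mgf0 : (0 <= mgf)%E.
  apply: integral_ge0 => x _.
  by rewrite lee_fin mulr_ge0 ?expR_ge0 ?nakagami_pdf_ge0.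
(* Adding 2 ensures [ln M > 0], so that [kap] below is well defined and positive. Finiteness of
   [mgf] is established later, once the density is known to have mass 1. *)
pose M0 := fine mgf; pose M := M0 + 2.
have M00 : 0 <= M0 by exact: fine_ge0.
have M1 : 1 < M by rewrite /M; lra.
have lnM0 : 0 < ln M by exact: ln_gt0.
pose de := th * b / beta / 2.
have de0 : 0 < de by rewrite !divr_gt0// mulr_gt0.
pose kap := de / ln M.
have kap0 : 0 < kap by rewrite divr_gt0.
have kapM : kap * ln M = de by rewrite /kap divfK// gt_eqF.
(* Truncation plus one gives [kap * L < k <= kap * L + 1], so the throughput [k] meets the bound
   with [c = kap]. *)
exists kap; split => //; exists (fun n => (Num.truncn (kap * ln (n%:R : R))).+1).
move=> d T P gam indX dX.
have int1 : (\int[@lebesgue_measure R]_x (nakagami_pdf m Om x)%:E = 1)%E.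
  have [_ /(_ setT measurableT) <-] := dX 1%N ord0 ord0.
  by rewrite preimage_setT probability_setT.
pose K := Gammaf m * powR (Om / m) m.
have K0 : 0 < K by exact: nakagami_norm_gt0.
have mg n i j : measurable_fun setT (gam n i j) by have [] := dX n i j.
have gM n i j : (\int[P]_t (expR (th * gam n i j t))%R%:E = M0%:E)%E.
  rewrite (integral_density P _ _ (fun x => expR (th * x)) (dX n i j)
    (measurable_nakagami_pdf m Om) (nakagami_pdf_ge0 m Om)) => [| |x].
  - by rewrite /M0 fineK// ge0_fin_numE// nakagami_mgf.
  - by apply: measurableT_comp => //; exact: measurable_funM.
  - exact: expR_ge0.
pose c1 := expR (- a) / K.
have c10 : 0 < c1 by rewrite divr_gt0 ?expR_gt0.
apply/cvgrPdist_le => e e0.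
have e20 : 0 < e / 2 by rewrite divr_gt0.
(* Four thresholds for [L]: [U1] for the last hypothesis of [few_exceedances_bound], [U2] for
   [k <= n], [U3] and [U4] to bring the two error probabilities below [e / 2] each. *)
have [U1 HU1] := linear_expR_le (kap + 1) 1 2^-1 (c1 / 2)
  ltac:(lra) ler01 ltac:(lra) ltac:(lra).
have [U2 HU2] := linear_expR_le kap 1 1 1 (ltW kap0) ler01 ltr01 ltr01.
have [U3 HU3] := linear_expR_le 0 1 1 (e / 2) (lexx _) ler01 ltr01 e20.
pose C := M * expR (th * N0).
have C0 : 0 < C by rewrite mulr_gt0 ?expR_gt0// (lt_trans ltr01).
have [U4 HU4] := linear_expR_le (kap * C) C de (e / 2)
  (mulr_ge0 (ltW kap0) (ltW C0)) (ltW C0) de0 e20.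
near=> n.
have n1 : 1 <= n%:R :> R by near: n; exact: nbhs_infty_ger.
have n0 : 0 < n%:R :> R by exact: lt_le_trans n1.
set L := ln (n%:R : R).
have nL : n%:R = expR L :> R by rewrite lnK.
have LU U : expR U <= n%:R -> U <= L by rewrite nL ler_expR.
have L1 : U1 <= L by apply: LU; near: n; exact: nbhs_infty_ger.
have L2 : U2 <= L by apply: LU; near: n; exact: nbhs_infty_ger.
have L3 : U3 <= L by apply: LU; near: n; exact: nbhs_infty_ger.
have L4 : U4 <= L by apply: LU; near: n; exact: nbhs_infty_ger.
(* This gives [x >= 1], as [nakagami_tail] requires. *)
have Lb : b^-1 <= L by apply: LU; near: n; exact: nbhs_infty_ger.
have L0 : 0 <= L by exact: ln_ge0.
set k := (Num.truncn _).+1.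
have kL : k%:R <= kap * L + 1.
  by rewrite /k -natr1 lerD2r truncn_le mulr_ge0// ltW.
have Lk : kap * L <= k%:R by apply/ltW/truncnS_gt.
have kn : (k <= n)%N.
  rewrite -(ler_nat R) (le_trans kL)// nL.
  have := HU2 _ L2; rewrite mul1r expRN ler_pdivrMr ?expR_gt0//.
  by rewrite mul1r.
pose x := b * L.
have x1 : 1 <= x.
  by rewrite -[leLHS](mulfV (lt0r_neq0 b0)) ler_wpM2l// ltW.
pose tail := (\int[@lebesgue_measure R]_(y in `]x, +oo[%classic)
  (nakagami_pdf m Om y)%:E)%E.
have Ptail q i j : P [set t | x < gam q i j t] = tail.
  transitivity (P (gam q i j @^-1` `]x, +oo[%classic)); last first.
    by have [_] := dX q i j; apply.
  congr (P _); apply/seteqP; split => t /=; rewrite in_itv/= andbT//.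
have mgt q i j : measurable [set t | x < gam q i j t].
  exact: measurable_ltr_event.
pose p := fine tail.
have pE : tail = p%:E.
  by rewrite /p fineK// -(Ptail 1%N ord0 ord0) fin_num_measure.
have p01 : 0 <= p <= 1.
  by rewrite -!lee_fin -pE -(Ptail 1%N ord0 ord0) measure_ge0 probability_le1.
have cp : c1 * expR (- (2^-1 * L)) <= p.
  have := nakagami_tail m Om x hm hOm x1; rewrite -/tail pE lee_fin.
  apply: le_trans; rewrite /c1 -/K mulrAC -expRD ler_wpM2r ?invr_ge0 ?(ltW K0)//.
  rewrite ler_expR -/a mulrDr mulr1 /x mulrA.
  have -> : a * b = 2^-1 by rewrite /b; field; exact: lt0r_neq0.
  lra.
have low := throughput_topk_prob P (gam n) N0 beta th M0 M x p k
  (fun q => kap * L <= q%:R) (indX n) (mg n) (fun i j => etrans (Ptail n i j) pE)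
  (gM n) hbeta (ltW th0) _ (ltW M1) kn Lk.
have B1 := few_exceedances_bound p c1 L kap n k p01 nL kL cp (HU1 _ L1).
have B2 := interference_bound M kap L th b beta N0 k (ltW M1) kapM kL.
have {}HU3 := HU3 _ L3; rewrite mul0r add0r !mul1r in HU3.
have {}HU4 := HU4 _ L4.
have MM : 0 <= M0 <= M by rewrite M00 lerDl ler0n.
move: (low MM) => {}low.
set A := [set t | _] in low *.
have mA : measurable A.
  exact: (measurable_throughput_topk _ _ _ _ (fun q => kap * L <= q%:R)).
have A1 : fine (P A) <= 1.
  by rewrite -lee_fin fineK ?fin_num_measure// probability_le1.
rewrite ger0_norm ?subr_ge0//.
have B2' : (kap * L + 1) * (M * expR (th * N0)) * expR (- (th * b / beta / 2 * L)) =
  (kap * C * L + C) * expR (- (de * L)).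
  by rewrite -/C -/de mulrDl mul1r mulrAC.
rewrite B2' in B2.
rewrite lerBlDr -lerBlDl (le_trans _ low)// lerD2l lerN2.
rewrite [leRHS]splitr lerD//; first exact: le_trans HU3.
exact: le_trans HU4.
Unshelve. all: by end_near.
Qed.
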